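(* Let $A\in\mathbf{R}^{n\times n}$, $B\in\mathbf{R}^{n\times p}$, $C\in\mathbf{R}^{q\times n}$, $K\in\mathbf{R}^{p\times n}$, $L\in\mathbf{R}^{n\times q}$. Let $\mathcal{G}\in\Gamma_N$ with row-stochastic matrix $\mathcal{D}$, and let $1,\lambda_2,\dots,\lambda_N$ be the eigenvalues of $\mathcal{D}$ (with multiplicity), where $1$ is simple and $|\lambda_i|<1$ for $i=2,\dots,N$. If $A+BK$ and $A+(1-\lambda_i)LC$, $i=2,\dots,N$, are all Schur stable, then the agents reach consensus under the observer-type protocol: for every initial condition $x_i(0),v_i(0)$, $\|x_i(k)-x_j(k)\|\to 0$ as $k\to\infty$ for all $i,j$.
   Context: Agents: $x_i(k+1)=Ax_i(k)+Bu_i(k)$, $y_i=Cx_i$, $i=1,\dots,N$. For a directed graph $\mathcal{G}$ on nodes $\{1,\dots,N\}$ (an edge $(j,i)$ means agent $i$ receives information from agent $j$), its row-stochastic matrix $\mathcal{D}=(d_{ij})\in\mathbf{R}^{N\times N}$ satisfies $d_{ii}>0$, $d_{ij}>0$ for $j\ne i$ iff $(j,i)$ is an edge and $d_{ij}=0$ otherwise, and $\sum_j d_{ij}=1$. $\Gamma_N$ is the set of directed graphs on $N$ nodes containing a directed spanning tree (a root node with a directed path to every other node). Protocol: $\zeta_i=\sum_{j=1}^N d_{ij}(y_i-y_j)$, $v_i(k+1)=(A+BK)v_i(k)+L\big(\sum_{j=1}^N d_{ij}C(v_i-v_j)-\zeta_i\big)$, $u_i=Kv_i$, with $v_i\in\mathbf{R}^n$.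 A matrix is Schur stable if all its eigenvalues have modulus $<1$. *)

(* Defs.v *)
(* classical reals (limits are needed). Matrices are
   functions nat -> nat -> R with explicit dimensions; vectors nat -> R;
   only indices below the stated dimension are meaningful. *)
From Stdlib Require Import Reals.
Open Scope R_scope.

Fixpoint fsum (m : nat) (f : nat -> R) : R :=
  match m with O => 0 | S m' => fsum m' f + f m' end.

Definition mv (c : nat) (M : nat -> nat -> R) (v : nat -> R) : nat -> R :=
  fun i => fsum c (fun j => M i j * v j).

Definition mm (m : nat) (M P : nat -> nat -> R) : nat -> nat -> R :=
  fun i j => fsum m (fun l => M i l * P l j).

Definition vnorm (n : nat) (w : nat -> R) : R :=
  sqrt (fsum n (fun a => w a ^ 2)).

Record Cx := mkCx { Cre : R; Cim : R }.
Definition C0 : Cx := mkCx 0 0.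
Definition RtoC (r : R) : Cx := mkCx r 0.
Definition Cadd (z w : Cx) : Cx := mkCx (Cre z + Cre w) (Cim z + Cim w).
Definition Csub (z w : Cx) : Cx := mkCx (Cre z - Cre w) (Cim z - Cim w).
Definition Cmul (z w : Cx) : Cx :=
  mkCx (Cre z * Cre w - Cim z * Cim w) (Cre z * Cim w + Cim z * Cre w).
Definition Cmod (z : Cx) : R := sqrt (Cre z ^ 2 + Cim z ^ 2).
Fixpoint Csum (m : nat) (f : nat -> Cx) : Cx :=
  match m with O => C0 | S m' => Cadd (Csum m' f) (f m') end.

Definition is_eigenvalue (m : nat) (M : nat -> nat -> Cx) (lam : Cx) : Prop :=
  exists v : nat -> Cx,
    (exists i, (i < m)%nat /\ v i <> C0) /\
    (forall i, (i < m)%nat -> Csum m (fun j => Cmul (M i j) (v j)) = Cmul lam (v i)).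

Definition schur_stable (m : nat) (M : nat -> nat -> Cx) : Prop :=
  forall lam, is_eigenvalue m M lam -> Cmod lam < 1.

Definition realC (M : nat -> nat -> R) : nat -> nat -> Cx :=
  fun i j => RtoC (M i j).

(* A directed graph on nodes 0..N-1 is a relation E; E j i means the
   edge (j,i): agent i receives information from agent j. *)
Inductive reach (N : nat) (E : nat -> nat -> Prop) (r : nat) : nat -> Prop :=
| reach_refl : reach N E r r
| reach_step : forall j i, reach N E r j -> (j < N)%nat -> (i < N)%nat ->
                 E j i -> reach N E r i.

(* G in Gamma_N: G contains a directed spanning tree *)
Definition in_GammaN (N : nat) (E : nat -> nat -> Prop) : Prop :=
  exists r, (r < N)%nat /\ forall i, (i < N)%nat -> reach N E r i.

Definition row_stochastic_of (N : nat) (E : nat -> nat -> Prop)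
    (D : nat -> nat -> R) : Prop :=
  forall i, (i < N)%nat ->
    D i i > 0 /\
    (forall j, (j < N)%nat -> j <> i ->
        (D i j > 0 <-> E j i) /\ (~ E j i -> D i j = 0)) /\
    fsum N (D i) = 1.

Definition closed_loop (n p q N : nat) (A B C K L D : nat -> nat -> R)
    (x v : nat -> nat -> nat -> R) : Prop :=
  forall i k, (i < N)%nat ->
    let zeta := fun c => fsum N (fun j => D i j *
                   (mv n C (x i k) c - mv n C (x j k) c)) in
    (forall a, (a < n)%nat ->
       x i (S k) a = mv n A (x i k) a + mv p B (mv n K (v i k)) a) /\
    (forall a, (a < n)%nat ->
       v i (S k) a =
         mv n (fun a b => A a b + mm p B K a b) (v i k) a +
         fsum q (fun c => L a c *
           (fsum N (fun j => D i j * (mv n C (v i k) c - mv n C (v j k) c))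
            - zeta c))).

(* Main.v *)
(* Put e_i = v_i - x_i and stack the e_i and v_i as the rows of matrices E and V.
   The closed loop becomes
     E(k+1) = E(k) A^T + (1 - D) E(k) (LC)^T,
     V(k+1) = V(k) (A + BK)^T + (1 - D) E(k) (LC)^T.
   Write the characteristic polynomial of D as (X - 1)^a p with p(1) <> 0.  By
   Cayley-Hamilton the columns of p(D) are generalized eigenvectors for the
   eigenvalue 1, and the maximum principle on a graph with a root makes those
   constant; hence U p(D) = 0 for every U with U 1 = 0.  Removing the factors
   D - lam of p(D) one at a time, each removal costing a Schur stable recurrence
   driven by a null input, gives U E -> 0.  The same removal of factors, with the
   scalar contraction z(k+1) - mu z(k) -> 0, shows that a Schur stable recurrence
   maps null inputs to null states, so no Jordan or Schur form is needed.  With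
   U = 1 - D this yields V -> 0, and then U X = U V - U E -> 0. *)
Require Import Defs.
From Stdlib Require Import Reals.
From mathcomp Require all_boot all_order all_algebra ring lra Rstruct complex.
Open Scope R_scope.

Module Consensus.
Import all_boot all_order all_algebra ring lra Rstruct complex.
Import Order.TTheory GRing.Theory Num.Theory.
Import ComplexField.Normc.
Local Open Scope ring_scope.
Local Open Scope complex_scope.
Set Implicit Arguments.
Unset Strict Implicit.
Unset Printing Implicit Defensive.

Local Notation R := Rdefinitions.R.
Local Notation C := R[i].

(** * Complex sequences tending to zero *)

Lemma normc_ge0 (z : C) : 0 <= normc z.
Proof. by case: z => a b; exact: sqrtr_ge0. Qed.

Lemma normc_real (x : R) : normc x%:C = `|x|.
Proof. by rewrite /= expr0n addr0 sqrtr_sqr. Qed.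

Definition null (z : nat -> C) : Prop :=
  forall e : R, 0 < e -> exists K, forall k, (K <= k)%N -> normc (z k) < e.

Lemma eq_null (y z : nat -> C) : y =1 z -> null y -> null z.
Proof.
move=> eq_yz ny e e0; have [K HK] := ny e e0.
by exists K => k /HK; rewrite eq_yz.
Qed.

Lemma null0 : null (fun=> 0).
Proof. by move=> e e0; exists 0%N => k _; rewrite normc0. Qed.

Lemma nullD (y z : nat -> C) : null y -> null z -> null (fun k => y k + z k).
Proof.
move=> ny nz e e0; have e20 : 0 < e / 2 by rewrite divr_gt0.
have [K HK] := ny _ e20; have [K' HK'] := nz _ e20.
exists (maxn K K') => k; rewrite geq_max => /andP[/HK hy /HK' hz].
by have := le_normcD (y k) (z k); lra.
Qed.

Lemma nullMl (c : C) (z : nat -> C) : null z -> null (fun k => c * z k).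
Proof.
move=> nz e e0; have c0 : 0 <= normc c by exact: normc_ge0.
have d0 : 0 < normc c + 1 by lra.
have [K HK] := nz _ (divr_gt0 e0 d0).
exists K => k /HK hz; rewrite normcM.
move: hz; rewrite ltr_pdivlMr // => hz.
have := normc_ge0 (z k); nra.
Qed.

Lemma null_sum (I : Type) (r : seq I) (F : I -> nat -> C) :
  (forall i, null (F i)) -> null (fun k => \sum_(i <- r) F i k).
Proof.
move=> nF; elim: r => [|i r IH].
  by apply: eq_null null0 => k; rewrite big_nil.
by apply: eq_null (nullD (nF i) IH) => k; rewrite big_cons.
Qed.

Lemma null_norm (z : nat -> C) : null z -> null (fun k => (normc (z k))%:C).
Proof.
move=> nz e e0; have [K HK] := nz e e0; exists K => k /HK.
by rewrite normc_real ger0_norm // normc_ge0.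
Qed.

Lemma null_contraction (mu : C) (z : nat -> C) :
  normc mu < 1 -> null (fun k => z k.+1 - mu * z k) -> null z.
Proof.
move=> mu1 nz e e0; have mu0 := normc_ge0 mu.
(* With this bound on the defect, [e / 2] is the fixed point of [t |-> normc mu * t + e / 2 * (1 -
   normc mu)], so the estimate [bound] propagates by induction. *)
have d0 : 0 < e / 2 * (1 - normc mu) by nra.
have [K HK] := nz _ d0.
have bound m : normc (z (K + m)%N) <= e / 2 + normc mu ^+ m * normc (z K).
  elim: m => [|m IH]; first by rewrite addn0 expr0; lra.
  have := HK (K + m)%N (leq_addr _ _).
  have := le_normcD (z (K + m).+1 - mu * z (K + m)%N) (mu * z (K + m)%N).
  rewrite addnS subrK normcM exprS; nra.
have a0 := normc_ge0 (z K).
(* The [+ 1] keeps the denominator positive when [z K = 0]. *)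
have y0 : 0 < e / 2 / (normc (z K) + 1) by rewrite !divr_gt0 //; lra.
have /RltP abs_mu1 : Rabs (normc mu) < 1 by rewrite RabsE ger0_norm.
have [M HM] := pow_lt_1_zero (normc mu) abs_mu1 _ (elimT RltP y0).
exists (K + M)%N => k Kk.
have -> : k = (K + (k - K))%N by rewrite subnKC // (leq_trans (leq_addr _ _) Kk).
have {}Kk : (M <= k - K)%N by rewrite leq_subRL // (leq_trans (leq_addr _ _) Kk).
have /RltP := HM _ (elimT ssrnat.leP Kk).
rewrite RpowE RabsE ger0_norm ?exprn_ge0 // ltr_pdivlMr; last lra.
have := bound (k - K)%N; have := exprn_ge0 (k - K) mu0; nra.
Qed.

(** * Matrix sequences tending to zero entrywise *)

Definition mxnull m n (Z : nat -> 'M[C]_(m, n)) : Prop :=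
  forall i j, null (fun k => Z k i j).

Lemma eq_mxnull m n (Y Z : nat -> 'M[C]_(m, n)) :
  Y =1 Z -> mxnull Y -> mxnull Z.
Proof. by move=> eq_YZ nY i j; apply: eq_null (nY i j) => k; rewrite eq_YZ. Qed.

Lemma mxnull0 m n : mxnull (fun=> 0 : 'M[C]_(m, n)).
Proof. by move=> i j; apply: eq_null null0 => k; rewrite mxE. Qed.

Lemma mxnullD m n (Y Z : nat -> 'M[C]_(m, n)) :
  mxnull Y -> mxnull Z -> mxnull (fun k => Y k + Z k).
Proof.
by move=> nY nZ i j; apply: eq_null (nullD (nY i j) (nZ i j)) => k; rewrite mxE.
Qed.

Lemma mxnullMr m n p (Z : nat -> 'M[C]_(m, n)) (P : 'M_(n, p)) :
  mxnull Z -> mxnull (fun k => Z k *m P).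
Proof.
move=> nZ i j; apply: eq_null (null_sum _ (fun l => nullMl (P l j) (nZ i l))) => k.
by rewrite mxE; apply: eq_bigr => l _; rewrite mulrC.
Qed.

Lemma mxnullMl m n p (P : 'M_(p, m)) (Z : nat -> 'M[C]_(m, n)) :
  mxnull Z -> mxnull (fun k => P *m Z k).
Proof.
move=> nZ i j; apply: eq_null (null_sum _ (fun l => nullMl (P i l) (nZ l j))) => k.
by rewrite mxE.
Qed.

Lemma mxnull_contraction m n (mu : C) (Z : nat -> 'M[C]_(m, n)) :
  normc mu < 1 -> mxnull (fun k => Z k.+1 - mu *: Z k) -> mxnull Z.
Proof.
move=> mu1 nZ i j; apply: null_contraction mu1 _.
by apply: eq_null (nZ i j) => k; rewrite !mxE.
Qed.

(** * Stable recurrences via factored matrix polynomials *)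

(** Used to descend from an annihilating product to the identity. The side is dictated by the state:
    the factor removed must stand next to it, on the right of [T] in [U *m T *m E k], on the left in
    [Z k *m T]. *)
Lemma peel_factors_right n (M : 'M[C]_n.+1) (s : seq C) (Q : 'M[C]_n.+1 -> Prop) :
  (forall T mu, mu \in s -> Q (T *m (M - mu%:M)) -> Q T) ->
  forall T, Q (T *m \prod_(mu <- s) (M - mu%:M)) -> Q T.
Proof.
elim: s => [|mu s IH] step T; first by rewrite big_nil mulmx1.
rewrite big_cons mulmxA => QT; apply: (step _ _ (mem_head _ _)).
apply: (IH _ _ QT) => U nu nu_s.
by apply: step; rewrite inE nu_s orbT.
Qed.

Lemma peel_factors_left n (M : 'M[C]_n.+1) (s : seq C) (Q : 'M[C]_n.+1 -> Prop) :
  (forall T mu, mu \in s -> Q ((M - mu%:M) *m T) -> Q T) ->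
  forall T, Q (\prod_(mu <- s) (M - mu%:M) *m T) -> Q T.
Proof.
elim: s => [|mu s IH] step T; first by rewrite big_nil mul1mx.
rewrite big_cons -mulmxA => QT.
apply: (IH _ _ (step _ _ (mem_head _ _) QT)) => U nu nu_s.
by apply: step; rewrite inE nu_s orbT.
Qed.

Lemma horner_mx_split n (M : 'M[C]_n.+1) (p : {poly C}) :
  exists2 s : seq C, p != 0 -> forall mu, (mu \in s) = root p mu &
    horner_mx M p = lead_coef p *: \prod_(mu <- s) (M - mu%:M).
Proof.
have [s def_p] := closed_field_poly_normal p; exists s.
  move=> p0 mu; rewrite def_p rootZ ?root_prod_XsubC //.
  by rewrite lead_coef_eq0.
rewrite {1}def_p linearZ rmorph_prod /=; congr (_ *: _).
by apply: eq_bigr => mu _; rewrite rmorphB /= horner_mx_X horner_mx_C.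
Qed.

Definition schur n (M : 'M[C]_n) : Prop :=
  forall mu, root (char_poly M) mu -> normc mu < 1.

Lemma schur_null m n (M : 'M[C]_n.+1) (Z : nat -> 'M[C]_(m, n.+1)) :
  schur M -> mxnull (fun k => Z k.+1 - Z k *m M) -> mxnull Z.
Proof.
move=> schurM nW.
have [s s_root] := horner_mx_split M (char_poly M).
have /monic_neq0 chi0 := char_poly_monic M.
rewrite Cayley_Hamilton (monicP (char_poly_monic M)) scale1r => prod0.
suff : mxnull (fun k => Z k *m (1%:M : 'M_n.+1)).
  by apply: eq_mxnull => k; rewrite mulmx1.
pose Q (T : 'M_n.+1) := mxnull (fun k => Z k *m T).
rewrite -/(Q 1%:M); apply: (@peel_factors_left _ M s Q); last first.
  by rewrite -prod0 mul0mx /Q; apply: eq_mxnull (@mxnull0 _ _) => k; rewrite mulmx0.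
move=> T mu /[!s_root]// /schurM mu1 nT; apply: mxnull_contraction mu1 _.
(* With [W k = Z k.+1 - Z k *m M], the scalar defect [Z k.+1 *m T - mu *: (Z k *m T)] equals
   [Z k *m (M - mu%:M) *m T + W k *m T], a sum of two null terms. *)
apply: eq_mxnull (mxnullD nT (mxnullMr T nW)) => k.
by rewrite mulmxA mulmxBr !mulmxBl mul_mx_scalar -scalemxAl addrC addrA subrK.
Qed.

(** Stability is required only at the roots of [p], and [p] need annihilate [D] only after
    multiplication by [U]; this leaves room to avoid the eigenvalue 1. *)
Lemma networked_null m n N (A G : 'M[C]_n.+1) (D : 'M[C]_N.+1) (p : {poly C})
    (E : nat -> 'M[C]_(N.+1, n.+1)) (U : 'M[C]_(m, N.+1)) :
  (forall k, E k.+1 = E k *m A + (1%:M - D) *m E k *m G) ->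
  p != 0 -> U *m horner_mx D p = 0 ->
  (forall lam, root p lam -> schur (A + (1 - lam) *: G)) ->
  mxnull (fun k => U *m E k).
Proof.
move=> dynE p0 Up stab.
have [s s_root def_p] := horner_mx_split D p.
pose Q (T : 'M_N.+1) := mxnull (fun k => U *m T *m E k).
suff : Q 1%:M by apply: eq_mxnull => k; rewrite mulmx1.
apply: (@peel_factors_right _ D s Q); last first.
  rewrite /Q; apply: eq_mxnull (@mxnull0 _ _) => k.
  move: Up; rewrite def_p -scalemxAr => /eqP.
  by rewrite scaler_eq0 lead_coef_eq0 (negPf p0) /= mul1mx => /eqP ->; rewrite mul0mx.
move=> T lam /[!s_root]// /stab stab_lam nT.
apply: schur_null stab_lam _.
apply: eq_mxnull (mxnullMr (- G) nT) => k.
(* [V E(k+1) - V E(k) (A + (1 - lam) G) = - V (D - lam) E(k) G] for [V = U T] *)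
rewrite mulmxA dynE; set V := U *m T.
rewrite mulmxBr mul_mx_scalar !mulmxDr !mulmxA mulmxBr mulmx1 mulmxN.
rewrite -scalemxAr scalerBl scale1r opprD opprB addrACA subrr add0r.
by rewrite !mulmxBl -!scalemxAl opprB addrC addrA subrK.
Qed.

(** * The eigenvalue 1 of a stochastic matrix with a root *)

Section Consensus_polynomial.
Variables (F : realFieldType) (N : nat) (D : 'M[F]_N.+1) (r : 'I_N.+1).
Hypothesis D_ge0 : forall i j, 0 <= D i j.
Hypothesis D_sum : forall i, \sum_j D i j = 1.
(* [r] is a root of the graph: it can be reached backwards from every node. *)
Hypothesis D_root : forall S : {set 'I_N.+1}, S != set0 ->
  (forall i j, i \in S -> 0 < D i j -> j \in S) -> r \in S.

(* [gap] writes [h i0 - h i - c] as a sum of nonnegative terms; it vanishes at the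
   maximum [i0], and the set of maximizers is closed under in-neighbours. *)
Lemma max_principle (h : 'cV[F]_N.+1) (c : F) :
  D *m h = h + const_mx c -> 0 <= c -> c = 0 /\ forall i, h i 0 <= h r 0.
Proof.
move=> Dh c0.
pose i0 := [arg max_(i > r) h i 0]%O.
have hmax i : h i 0 <= h i0 0.
  by rewrite /i0; case: arg_maxP => // j _; exact.
have gap i : \sum_j D i j * (h i0 0 - h j 0) = h i0 0 - h i 0 - c.
  have -> : h i0 0 - h i 0 - c = h i0 0 - (D *m h) i 0.
    by rewrite Dh !mxE; ring.
  rewrite mxE -[X in X - _]mul1r -(D_sum i) mulr_suml -sumrB.
  by apply: eq_bigr => j _; rewrite mulrBr.
have gap_ge0 i j : 0 <= D i j * (h i0 0 - h j 0).
  by rewrite mulr_ge0 // subr_ge0.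
have c_eq0 : c = 0.
  apply/eqP; rewrite eq_le c0 andbT -oppr_ge0.
  by have := gap i0; rewrite subrr sub0r => <-; exact: sumr_ge0.
split=> //; suff : r \in [set i | h i 0 == h i0 0].
  by rewrite inE => /eqP ->.
apply: D_root => [|i j /[!inE] /eqP hi Dij].
  by apply/set0Pn; exists i0; rewrite inE.
have /eqP := gap i; rewrite hi subrr c_eq0 subr0 psumr_eq0 // => /allP.
move=> /(_ j (mem_index_enum _)); rewrite mulf_eq0 gt_eqF //=.
by rewrite subr_eq0 eq_sym.
Qed.

(** One of [c] and [- c] is nonnegative, so the maximum principle applies to [h] or to [- h] and
    gives [c = 0]; it then applies to the other one too. Hence [h r 0] is both the maximum and the
    minimum. *)
Lemma shifted_eigenvector_const (h : 'cV[F]_N.+1) (c : F) :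
  D *m h = h + const_mx c -> h = const_mx (h r 0).
Proof.
move=> Dh.
have DhN : D *m - h = - h + const_mx (- c).
  by rewrite mulmxN Dh opprD; congr (_ + _); apply/matrixP => i j; rewrite !mxE.
suff [hle hge] : (forall i, h i 0 <= h r 0) /\ (forall i, (- h) i 0 <= (- h) r 0).
  apply/matrixP => i j; rewrite ord1 mxE; apply/eqP; rewrite eq_le hle /=.
  by have := hge i; rewrite !mxE lerN2.
have [c_ge0|/ltW c_le0] := leP 0 c.
  have [c0 hle] := max_principle Dh c_ge0; split=> //.
  by have [] := max_principle DhN; rewrite c0 ?oppr0.
have [|c0 hge] := max_principle DhN; first by rewrite oppr_ge0.
by split=> //; have [] := max_principle Dh; rewrite // -[c]opprK c0 oppr0.
Qed.

(** By induction [(D - 1) h] is constant, which is exactly the shifted eigenvector equation; the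
    shift then turns out to be zero, so no Jordan chain starts at the constants. *)
Lemma generalized_eigenvector_const a (h : 'cV[F]_N.+1) :
  (D - 1%:M) ^+ a *m h = 0 -> h = const_mx (h r 0).
Proof.
elim: a h => [|a IH] h.
  by rewrite expr0 mul1mx => ->; apply/matrixP => i j; rewrite !mxE.
rewrite exprSr -mulmxA => /IH; rewrite mulmxBl mul1mx => /(canRL (subrK _)).
by rewrite addrC => /shifted_eigenvector_const.
Qed.

(** The middle two properties make every root of [p] an eigenvalue of [D] other than 1, which is
    where stability is assumed. *)
Lemma consensus_poly : exists p : {poly F},
  [/\ p != 0, ~~ root p 1, p %| char_poly D &
    forall m (U : 'M_(m, N.+1)), U *m const_mx 1 = 0 :> 'cV_m -> U *m horner_mx D p = 0].
Proof.
have chi0 := monic_neq0 (char_poly_monic D).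
have [a [p p1 def_chi]] := multiplicity_XsubC (char_poly D) 1.
exists p; split; [|by rewrite chi0 in p1| |].
- by apply: contraNneq chi0 => p0; rewrite def_chi p0 mul0r.
- by rewrite def_chi dvdp_mulr.
move=> m U U1; have := Cayley_Hamilton D.
rewrite def_chi mulrC rmorphM rmorphXn rmorphB /= horner_mx_X horner_mx_C => chiD.
suff colU j : U *m col j (horner_mx D p) = 0.
  apply/matrixP => i j; have /matrixP/(_ i 0) := colU j; rewrite !mxE => Uij0.
  by rewrite -[RHS]Uij0; apply: eq_bigr => l _; rewrite mxE.
have /generalized_eigenvector_const -> : (D - 1%:M) ^+ a *m col j (horner_mx D p) = 0.
  by rewrite colE mulmxA [_ *m horner_mx D p]chiD mul0mx.
set c := fun_of_matrix _ r 0.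
by rewrite -[c]mulr1 -scalemx_const -scalemxAr U1 scaler0.
Qed.

End Consensus_polynomial.

(** * The closed loop in matrix form *)

Local Notation "M ^C" := (map_mx (real_complex R) M) (at level 1, format "M ^C").

(** The maximum principle needs an ordered field and the splitting into linear factors a closed one,
    so [p] is found over the reals and then mapped to the complex numbers. *)
Lemma networked_disagreement_null m n N (D : 'M[R]_N.+1) (r : 'I_N.+1)
    (A G : 'M[C]_n.+1) (E : nat -> 'M[C]_(N.+1, n.+1)) (U : 'M[R]_(m, N.+1)) :
  (forall i j, 0 <= D i j) -> (forall i, \sum_j D i j = 1) ->
  (forall S : {set 'I_N.+1}, S != set0 ->
    (forall i j, i \in S -> 0 < D i j -> j \in S) -> r \in S) ->
  (forall k, E k.+1 = E k *m A + (1%:M - D^C) *m E k *m G) ->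
  (forall lam, root (char_poly D^C) lam -> lam != 1 ->
    schur (A + (1 - lam) *: G)) ->
  U *m const_mx 1 = 0 :> 'cV_m -> mxnull (fun k => U^C *m E k).
Proof.
move=> D_ge0 D_sum D_root dynE stab U1.
have [p [p0 p1 dvd_p Up]] := consensus_poly D_ge0 D_sum D_root.
apply: (networked_null (p := map_poly (real_complex R) p) dynE).
- by rewrite map_poly_eq0.
- by rewrite -map_horner_mx -map_mxM Up // map_mx0.
move=> lam p_lam; apply: stab.
  move: p_lam; rewrite -!dvdp_XsubCl => /dvdp_trans; apply.
  by rewrite -map_char_poly dvdp_map.
apply: contraNneq p1 => lam1; move: p_lam.
by rewrite lam1 -(rmorph1 (real_complex R)) fmorph_root.
Qed.

Lemma observer_disagreement_null m n N (D : 'M[R]_N.+1) (r : 'I_N.+1)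
    (A BK G : 'M[R]_n.+1) (X V : nat -> 'M[R]_(N.+1, n.+1)) (U : 'M[R]_(m, N.+1)) :
  (forall i j, 0 <= D i j) -> (forall i, \sum_j D i j = 1) ->
  (forall S : {set 'I_N.+1}, S != set0 ->
    (forall i j, i \in S -> 0 < D i j -> j \in S) -> r \in S) ->
  (forall k, X k.+1 = X k *m A + V k *m BK) ->
  (forall k, V k.+1 = V k *m (A + BK) + (1%:M - D) *m (V k - X k) *m G) ->
  schur (A + BK)^C ->
  (forall lam, root (char_poly D^C) lam -> lam != 1 ->
    schur (A^C + (1 - lam) *: G^C)) ->
  U *m const_mx 1 = 0 :> 'cV_m -> mxnull (fun k => (U *m X k)^C).
Proof.
move=> D_ge0 D_sum D_root dynX dynV stabM stab U1.
pose E k := (V k - X k)^C.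
have dynE k : E k.+1 = E k *m A^C + (1%:M - D^C) *m E k *m G^C.
  rewrite /E -(map_mx1 (real_complex R)) -map_mxB -!map_mxM -map_mxD.
  rewrite dynX dynV; congr (_ ^C).
  rewrite addrAC; congr (_ + _).
  by rewrite mulmxDr mulmxBl opprD addrACA subrr addr0.
(* Needed twice: with [1%:M - D] for the forcing of [V], and with [U] itself. *)
have nullE l (W : 'M[R]_(l, N.+1)) : W *m const_mx 1 = 0 :> 'cV_l ->
    mxnull (fun k => W^C *m E k).
  exact: networked_disagreement_null D_root dynE stab.
have nullV : mxnull (fun k => (V k)^C).
  apply: schur_null stabM _.
  apply: eq_mxnull (mxnullMr G^C (nullE _ (1%:M - D) _)) => [k|].
    by rewrite dynV [in RHS]map_mxD !map_mxM [RHS]addrC addKr.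
  (* [1%:M - D] annihilates constants because the rows of [D] sum to 1. *)
  apply/matrixP => i j; rewrite mulmxBl mul1mx !mxE -[X in X - _](D_sum i).
  by rewrite -sumrB big1 // => l _; rewrite mxE mulr1 subrr.
apply: eq_mxnull (mxnullD (mxnullMl U^C nullV) (mxnullMl (-1)%:M (nullE _ U U1))) => k.
by rewrite mul_scalar_mx scaleN1r -mulmxBr /E -map_mxB -map_mxM subKr.
Qed.

(** * Translation from the concrete definitions *)

Definition cx (z : Cx) : C := Cre z +i* Cim z.

Lemma cx_inj : injective cx.
Proof. by move=> [a b] [c d] [-> ->]. Qed.

Lemma cxD z w : cx (Cadd z w) = cx z + cx w.
Proof. by []. Qed.

Lemma cxB z w : cx (Csub z w) = cx z - cx w.
Proof. by []. Qed.

Lemma cxM z w : cx (Cmul z w) = cx z * cx w.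
Proof. by []. Qed.

Lemma cx_sum m f : cx (Csum m f) = \sum_(i < m) cx (f i).
Proof. by elim: m => [|m IH]; rewrite ?big_ord0 // big_ord_recr -IH. Qed.

Lemma normc_cx z : normc (cx z) = Cmod z.
Proof. by rewrite /Cmod RsqrtE !RpowE. Qed.

Lemma fsumE n f : fsum n f = \sum_(i < n) f i.
Proof. by elim: n => [|n IH]; rewrite ?big_ord0 // big_ord_recr -IH. Qed.

Definition mx_of (T : Type) m n (M : nat -> nat -> T) : 'M[T]_(m, n) :=
  \matrix_(i, j) M i j.

Lemma char_poly_tr (S : comNzRingType) n (M : 'M[S]_n) : char_poly M^T = char_poly M.
Proof.
rewrite /char_poly -det_tr; congr (\det _).
by apply/matrixP => i j; rewrite !mxE eq_sym.
Qed.

(* [is_eigenvalue] uses column vectors, MathComp's [eigenvalue] row vectors;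
   hence the transposition. *)
Lemma root_is_eigenvalue m (M : nat -> nat -> Cx) (mu : C) :
  root (char_poly (mx_of m m (fun i j => cx (M j i)))) mu ->
  is_eigenvalue m M (mkCx (complex.Re mu) (complex.Im mu)).
Proof.
rewrite -eigenvalue_root_char => /eigenvalueP[v Mv v0].
pose w j : Cx :=
  if insub j is Some j' then mkCx (complex.Re (v 0 j')) (complex.Im (v 0 j'))
  else Defs.C0.
have cx_w (j : 'I_m) : cx (w j) = v 0 j.
  by rewrite /w valK /cx /=; case: (v 0 j).
exists w; split.
  have /rV0Pn[j vj] := v0.
  exists j; split; first exact/ssrnat.ltP.
  by move=> wj; move: vj; rewrite -cx_w wj eqxx.
move=> i /ssrnat.ltP lt_im; apply: cx_inj; rewrite cx_sum cxM.
have /rowP/(_ (Ordinal lt_im)) := Mv; rewrite !mxE -cx_w /= => def_vi.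
transitivity (mu * cx (w i)); last by congr (_ * _); case: (mu).
rewrite -def_vi; apply: eq_bigr => j _.
by rewrite cxM mxE cx_w mulrC.
Qed.

(** The transpose is the form required: agent states are stacked as rows, so the system matrices act
    from the right. *)
Lemma schur_stable_schur m (M : nat -> nat -> Cx) :
  schur_stable m M -> schur (mx_of m m (fun i j => cx (M j i))).
Proof.
move=> stab mu /root_is_eigenvalue /stab /RltP; rewrite -normc_cx.
by case: mu.
Qed.

Lemma mx_of_mv m n c M (w : nat -> nat -> R) :
  mx_of m n (fun i => mv c M (w i)) = mx_of m c w *m (mx_of n c M)^T.
Proof.
apply/matrixP => i j; rewrite !mxE /mv fsumE.
by apply: eq_bigr => l _; rewrite !mxE mulrC.
Qed.

Lemma mx_of_mm m n p (M P : nat -> nat -> R) :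
  mx_of m n (mm p M P) = mx_of m p M *m mx_of p n P.
Proof.
apply/matrixP => i j; rewrite !mxE /mm fsumE.
by apply: eq_bigr => l _; rewrite !mxE.
Qed.

Lemma mx_of_laplacian N m (D w : nat -> nat -> R) :
  (forall i : 'I_N, \sum_(j < N) D i j = 1) ->
  mx_of N m (fun i c => fsum N (fun j => Rmult (D i j) (Rminus (w i c) (w j c)))) =
    (1%:M - mx_of N N D) *m mx_of N m w.
Proof.
move=> D_sum; apply/matrixP => i c; rewrite mulmxBl mul1mx !mxE fsumE.
rewrite -[w i c in RHS]mul1r -(D_sum i) mulr_suml -sumrB.
by apply: eq_bigr => j _; rewrite !mxE -mulrBr.
Qed.

Lemma vnorm_le n (w : nat -> R) : vnorm n w <= \sum_(a < n) `|w a|.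
Proof.
have sum_ge0 m : 0 <= \sum_(a < m) `|w a| by exact: sumr_ge0.
rewrite /vnorm RsqrtE -[leRHS]ger0_norm // -sqrtr_sqr ler_wsqrtr // fsumE.
under eq_bigr do rewrite RpowE.
elim: n => [|n IH]; first by rewrite !big_ord0 expr0n.
(* The cross term in the square of the sum is nonnegative and is dropped. *)
rewrite !big_ord_recr /= sqrrD -[w n ^+ 2]real_normK ?num_real //.
rewrite lerD2r (le_trans IH) // lerDl mulrn_wge0 // mulr_ge0 //.
exact: sum_ge0.
Qed.

Lemma null_vnorm n (w : nat -> nat -> R) :
  (forall a : 'I_n, null (fun k => (w k a)%:C)) -> Un_cv (fun k => vnorm n (w k)) R0.
Proof.
move=> nw e /RltP e0.
have [K HK] := null_sum (index_enum 'I_n) (fun a => null_norm (nw a)) e0.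
exists K => k /ssrnat.leP /HK; rewrite -rmorph_sum normc_real.
move=> lt_e; apply/RltP; rewrite RdistE subr0 ger0_norm; last first.
  by rewrite /vnorm RsqrtE sqrtr_ge0.
apply: le_lt_trans (vnorm_le _ _) _; apply: le_lt_trans lt_e.
apply: le_trans (ler_norm _); rewrite le_eqVlt; apply/orP; left; apply/eqP.
by apply: eq_bigr => a _; rewrite normc_real.
Qed.

(** Walk the path from [r] to [i] backwards: each edge gives a positive entry of [D], so membership
    in [S] passes to the predecessor. *)
Lemma root_in_closed_set N (E : nat -> nat -> Prop) (D : nat -> nat -> R)
    (r : 'I_N) (S : {set 'I_N}) (i : 'I_N) :
  row_stochastic_of N E D -> reach N E r i -> i \in S ->
  (forall i j : 'I_N, i \in S -> 0 < D i j -> j \in S) -> r \in S.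
Proof.
move=> stochD ri iS closedS; move: iS.
have : forall i' : 'I_N, i' = i :> nat -> i' \in S -> r \in S.
  elim: ri => [i' /val_inj -> //|l m _ IH /ssrnat.ltP lN /ssrnat.ltP mN Elm i' i'm i'S].
  apply: (IH (Ordinal lN)) => //; apply: closedS i'S _.
  have [Dmm [offdiag _]] := stochD m (elimT ssrnat.ltP mN).
  (* An edge may be a self-loop, to which the off-diagonal clause does not apply; the positive
     diagonal covers it. *)
  apply/RltP; rewrite i'm /=; have [->|/eqP lm] := eqVneq l m; first exact: Dmm.
  by have [[_ pos] _] := offdiag l (elimT ssrnat.ltP lN) lm; exact: pos.
by move/(_ i erefl).
Qed.

Lemma observer_consensus (n p q N : nat) (A B C K L : nat -> nat -> R)
    (E : nat -> nat -> Prop) (D : nat -> nat -> R) :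
  in_GammaN N E ->
  row_stochastic_of N E D ->
  schur_stable n (realC (fun a b => Rplus (A a b) (mm p B K a b))) ->
  (forall lam, is_eigenvalue N (realC D) lam -> lam <> RtoC R1 ->
     schur_stable n (fun a b => Cadd (RtoC (A a b))
                                     (Cmul (Csub (RtoC R1) lam) (RtoC (mm q L C a b))))) ->
  forall x v : nat -> nat -> nat -> R,
    closed_loop n p q N A B C K L D x v ->
    forall i j, (i < N)%coq_nat -> (j < N)%coq_nat ->
      Un_cv (fun k => vnorm n (fun a => Rminus (x i k a) (x j k a))) R0.
Proof.
move=> [r [/ssrnat.ltP rN rootr]] stochD stabM stab x v loop i j.
move=> /ssrnat.ltP iN /ssrnat.ltP jN.
case: N => [|N] // in rN rootr stochD stab loop iN jN *.
(* The matrix lemmas concern sizes [n.+1]; for [n = 0] the norm is an empty sum. *)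
case: n => [|n] in stabM stab loop *.
  by apply: null_vnorm => -[].
pose r' := Ordinal rN; pose i' := Ordinal iN; pose j' := Ordinal jN.
pose MD := mx_of N.+1 N.+1 D.
pose MA := (mx_of n.+1 n.+1 A)^T.
pose MBK := (mx_of n.+1 n.+1 (mm p B K))^T.
pose MLC := (mx_of n.+1 n.+1 (mm q L C))^T.
pose X k := mx_of N.+1 n.+1 (fun i a => x i k a).
pose V k := mx_of N.+1 n.+1 (fun i a => v i k a).
have D_ge0 (l m : 'I_N.+1) : 0 <= MD l m.
  rewrite mxE; have [Dll [offdiag _]] := stochD l (elimT ssrnat.ltP (ltn_ord l)).
  have [->|/eqP ml] := eqVneq (m : nat) l; first exact/ltW/RltP.
  have [[_ pos] zero] := offdiag m (elimT ssrnat.ltP (ltn_ord m)) ml.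
  (* The edge relation is an arbitrary proposition, so the case split is classical. *)
  have [Eml|/zero ->//] := Classical_Prop.classic (E m l).
  exact/ltW/RltP/pos.
have D_sum' (l : 'I_N.+1) : \sum_(m < N.+1) D l m = 1.
  by rewrite -fsumE; have [_ []] := stochD l (elimT ssrnat.ltP (ltn_ord l)).
have D_sum (l : 'I_N.+1) : \sum_m MD l m = 1.
  by rewrite -(D_sum' l); apply: eq_bigr => m _; rewrite mxE.
have D_root (S : {set 'I_N.+1}) : S != set0 ->
    (forall l m, l \in S -> 0 < MD l m -> m \in S) -> r' \in S.
  move=> /set0Pn[l lS] closedS.
  have reach_l := rootr l (elimT ssrnat.ltP (ltn_ord l)).
  apply: (root_in_closed_set (r := r') stochD reach_l lS).
  by move=> l' m' l'S Dlm; apply: closedS l'S _; rewrite mxE.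
have dynX k : X k.+1 = X k *m MA + V k *m MBK.
  rewrite /X /V /MA /MBK mx_of_mm trmx_mul mulmxA -!mx_of_mv.
  apply/matrixP => l a; rewrite !mxE.
  by have [-> //] := loop l k (elimT ssrnat.ltP (ltn_ord l)); apply/ssrnat.ltP.
have dynV k : V k.+1 = V k *m (MA + MBK) + (1%:M - MD) *m (V k - X k) *m MLC.
  (* Splitting [(LC)^T] as [C^T L^T] exposes the outputs of [V] and [X], whose weighted differences
     are products with [1%:M - MD]. *)
  rewrite /X /V /MD /MLC mx_of_mm trmx_mul mulmxA -[_ *m (_ - _) *m _]mulmxA.
  rewrite (mulmxBl (mx_of _ _ _)) -!mx_of_mv.
  rewrite mulmxBr -!mx_of_laplacian //.
  have -> : MA + MBK = (mx_of n.+1 n.+1 (fun a b => Rplus (A a b) (mm p B K a b)))^T.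
    by apply/matrixP => a b; rewrite !mxE.
  rewrite -mx_of_mv.
  apply/matrixP => l a.
  have [_ dyn_v] := loop l k (elimT ssrnat.ltP (ltn_ord l)).
  rewrite mxE dyn_v; last exact/ssrnat.ltP.
  rewrite !mxE fsumE; congr (_ + _); apply: eq_bigr => c _.
  by rewrite !mxE mulrC.
have stabM' : schur (MA + MBK)^C.
  move: stabM => /schur_stable_schur; congr (schur _).
  by apply/matrixP => a b; rewrite !mxE.
have stab' lam : root (char_poly MD^C) lam -> lam != 1 ->
    schur (MA^C + (1 - lam) *: MLC^C).
  move=> root_lam lam1.
  have /stab : is_eigenvalue N.+1 (realC D) (mkCx (complex.Re lam) (complex.Im lam)).
    (* Unlike the system matrices, [D] acts from the left, so the transposition has to be undone. *)
    apply: root_is_eigenvalue; move: root_lam; rewrite -char_poly_tr.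
    by congr (root (char_poly _) _); apply/matrixP => l m; rewrite !mxE.
  have cx_lam : cx (mkCx (complex.Re lam) (complex.Im lam)) = lam by case: (lam).
  have lam_neq : mkCx (complex.Re lam) (complex.Im lam) <> RtoC R1.
    by move=> lam_eq; move: lam1; rewrite -cx_lam lam_eq eqxx.
  move=> /(_ lam_neq) /schur_stable_schur; congr (schur _).
  by apply/matrixP => a b; rewrite !mxE cxD cxM cxB cx_lam.
apply: null_vnorm => a.
(* This row vector kills constants, and [U *m X k] is the difference of the states of agents [i] and
   [j]. *)
pose U : 'rV[R]_N.+1 := delta_mx 0 i' - delta_mx 0 j'.
have U1 : U *m const_mx 1 = 0 :> 'cV_1.
  by rewrite mulmxBl -!rowE; apply/matrixP => l m; rewrite !mxE subrr.
have := observer_disagreement_null D_ge0 D_sum D_root dynX dynV stabM' stab' U1.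
move=> /(_ 0 a); apply: eq_null => k.
by rewrite mxE mulmxBl -!rowE !mxE.
Qed.

End Consensus.

Theorem theorem1 (n p q N : nat) (A B C K L : nat -> nat -> R)
  (E : nat -> nat -> Prop) (D : nat -> nat -> R) :
  in_GammaN N E ->
  row_stochastic_of N E D ->
  schur_stable n (realC (fun a b => A a b + mm p B K a b)) ->
  (forall lam, is_eigenvalue N (realC D) lam -> lam <> RtoC 1 ->
     schur_stable n (fun a b => Cadd (RtoC (A a b))
                                     (Cmul (Csub (RtoC 1) lam) (RtoC (mm q L C a b))))) ->
  forall x v : nat -> nat -> nat -> R,
    closed_loop n p q N A B C K L D x v ->
    forall i j, (i < N)%nat -> (j < N)%nat ->
      Un_cv (fun k => vnorm n (fun a => x i k a - x j k a)) 0.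
Proof. exact (@Consensus.observer_consensus n p q N A B C K L E D). Qed.
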